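(* Let $\Omega\subset\mathbb{R}^d$ be compact and let $F$ be a real-valued function on the set $\mathcal{P}(\Omega)$ of probability measures on $\Omega$. Suppose that $F$ is convex and smooth in $\mu$. Then $$\min_{\mu_n}F(\mu_n)-F^*=O\left(\frac1n\right)$$ for all $n\ge 1$; that is, there is a constant $C$ independent of $n$ such that the left-hand side is at most $C/n$ for every $n\ge1$. Here the minimum is over measures $\mu_n=\frac1n\sum_{i=1}^n\delta_{w_i}$ with $w_i\in\Omega$.
   Context: $F^*=\inf_{\mu\in\mathcal{P}(\Omega)}F(\mu)$, and $\min_{\mu_n}$ is understood as an infimum if it is not attained. Convex in $\mu$ means convex with respect to the usual mixtures $(1-t)\mu+t\nu$ of measures. Smooth in $\mu$ means: there is $\ell\ge 0$ and, for every $\mu\in\mathcal{P}(\Omega)$, a bounded measurable function $F'[\mu]:\Omega\to\mathbb{R}$ which is the first variation of $F$ at $\mu$, i.e. $\frac{d}{dt}F(\mu+t(\nu-\mu))|_{t=0^+}=\int F'[\mu]\,d(\nu-\mu)$ for all $\nu\in\mathcal{P}(\Omega)$, such that $$F(\nu)\le F(\mu)+\int F'[\mu]\,d(\nu-\mu)+\frac{\ell}{2}\|\nu-\mu\|_{TV}^2\qquad\text{for all }\mu,\nu\in\mathcal{P}(\Omega),$$ with $\|\cdot\|_{TV}$ the total variation norm of signed measures. *)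

(* Defs.v *)
From HB Require Import structures.
From mathcomp Require Import all_boot all_order all_algebra.
From mathcomp Require Import all_classical all_reals all_analysis.

Set Implicit Arguments.
Unset Strict Implicit.
Unset Printing Implicit Defensive.

Import Order.TTheory GRing.Theory Num.Theory.
Import numFieldNormedType.Exports.

Local Open Scope classical_set_scope.
Local Open Scope ring_scope.

(** R^d with its Borel sigma-algebra. *)
Definition borel_rV (R : realType) (d : nat) :=
  g_sigma_algebraType (@open 'rV[R]_d).

Section mixture.
Context {d : measure_display} {T : measurableType d} {R : realType}.
Variables (mu nu : probability T R) (t : {i01 R}).

(** (1 - t) mu + t nu *)
Definition mixture : set T -> \bar R :=
  measure_add (mscale (1 - t%:num)%:nng mu) (mscale t%:num%:nng nu).

HB.instance Definition _ := Measure.on mixture.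

Let mixture_setT : mixture setT = 1%E.
Proof.
by rewrite /mixture measure_addE /= /mscale /= !probability_setT !mule1
  -EFinD subrK.
Qed.

HB.instance Definition _ :=
  Measure_isProbability.Build _ _ _ mixture mixture_setT.

End mixture.

(** Projection of the real line onto [0, 1]; the identity on [0, 1]. *)
Section clamp01.
Context {R : realType}.
Variable t : R.

Let clamp_ge0 : 0 <= Num.max 0 (Num.min t 1).
Proof. by rewrite le_max lexx. Qed.

Let clamp_le1 : Num.max 0 (Num.min t 1) <= 1.
Proof. by rewrite ge_max ler01 ge_min lexx orbT. Qed.

Definition clamp01 : {i01 R} := Itv01 clamp_ge0 clamp_le1.

End clamp01.

Section tv_norm.
Context {d : measure_display} {T : measurableType d} {R : realType}.

(** |sigma|(T), where |sigma| is computed on a Hahn decomposition of sigma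
    (it does not depend on which one). *)
Definition tv_norm (sigma : {charge set T -> \bar R}) : R :=
  let: exist P exN := cid (Hahn_decomposition sigma) in
  let: exist N sigmaPN := cid exN in
  fine (charge_variation sigmaPN setT).

Definition charge_diff (nu mu : probability T R) : {charge set T -> \bar R} :=
  cadd (charge_of_finite_measure nu) (copp (charge_of_finite_measure mu)).

End tv_norm.

Section functionals.
Context {d : measure_display} {T : measurableType d} {R : realType}.
Implicit Types (Omega : set T) (F : probability T R -> R).

(** P(Omega), as the probability measures on the ambient space which are
    concentrated on Omega.  Functionals on P(Omega) are represented by functions
    on all of [probability T R] whose values outside P(Omega) are unconstrained. *)
Definition prob_on Omega : set (probability T R) := [set mu | mu Omega = 1%E].

Definition convex_on_prob Omega F :=
  forall mu nu, prob_on Omega mu -> prob_on Omega nu -> forall t : {i01 R},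
    F (mixture mu nu t) <= (1 - t%:num) * F mu + t%:num * F nu.

(** The integral of f over Omega against the signed measure nu - mu. *)
Definition int_diff Omega (nu mu : probability T R) (f : T -> R) : R :=
  \int[nu]_(x in Omega) f x - \int[mu]_(x in Omega) f x.

(** f is a first variation of F at mu.  The clamping is inactive for
    0 <= t <= 1, hence for t near 0 on the right. *)
Definition first_variation Omega F (mu : probability T R) (f : T -> R) :=
  forall nu, prob_on Omega nu ->
    (F (mixture mu nu (clamp01 t)) - F mu) / t @[t --> 0^'+]
      --> int_diff Omega nu mu f.

Definition smooth_on_prob Omega F :=
  exists l : R, 0 <= l /\
  exists F' : probability T R -> T -> R, forall mu, prob_on Omega mu ->
    [/\ measurable_fun Omega (F' mu),
        [bounded F' mu x | x in Omega],
        first_variation Omega F mu (F' mu) &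
        forall nu, prob_on Omega nu ->
          F nu <= F mu + int_diff Omega nu mu (F' mu)
                  + l / 2 * tv_norm (charge_diff nu mu) ^+ 2].

(** The measures (1/n) sum_(i < n) delta_(w i) with all w i in Omega.  Measures
    in the library are functions on all sets whose values on nonmeasurable sets
    are irrelevant, hence the restriction to measurable A. *)
Definition empirical_measures Omega (n : nat) : set (probability T R) :=
  [set mu | exists w : 'I_n -> T, (forall i, Omega (w i)) /\
     forall A, measurable A ->
       mu A = ((n%:R^-1)%:E * \sum_(i < n) \d_(w i) A)%E].

End functionals.

(* Main.v *)
(* Among n-atom uniform measures, take mu with F mu close to the infimum h_n,
   and let f be the first variation of F at mu.  Replace an atom w_i for which
   f (w_i) is at least the mean of f over the atoms by a point y where f is at
   most (essentially) the nu-average of f, nu being nearly optimal for F.  The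
   result mu' is again an n-atom uniform measure, at total variation distance at
   most 2/n from mu, so smoothness and then convexity give
     F mu' <= F mu + (f y - f (w_i)) / n + 2 l / n^2
           <= F mu - (F mu - F nu) / n + 2 l / n^2   (up to epsilon).
   As F mu' >= h_n, passing to the infimum gives (h_n - inf F) / n <= 2 l / n^2,
   that is C = 2 l. *)

Require Import Defs.
From HB Require Import structures.
From mathcomp Require Import all_boot all_order all_algebra.
From mathcomp Require Import all_classical all_reals all_analysis.
From mathcomp Require Import measurable_realfun ring lra.

Set Implicit Arguments.
Unset Strict Implicit.
Unset Printing Implicit Defensive.

Import Order.TTheory GRing.Theory Num.Theory.
Import numFieldNormedType.Exports.
Local Open Scope classical_set_scope.
Local Open Scope ring_scope.

(** * Uniform measures on finitely many atoms, and integration against them *)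

Section empirical.
Context {d : measure_display} {T : measurableType d} {R : realType}.

Section measure.
Variables (n : nat) (w : 'I_n.+1 -> T).

(* [msum] takes a sequence indexed by [nat], hence the [inord]. *)
Definition empirical : set T -> \bar R :=
  mscale (n.+1%:R^-1)%:nng (msum (fun k => \d_(w (inord k))) n.+1).

HB.instance Definition _ := Measure.on empirical.

Lemma empiricalE A :
  empirical A = ((n.+1%:R^-1)%:E * \sum_(i < n.+1) \d_(w i) A)%E.
Proof.
rewrite /empirical /mscale/= /msum; congr (_ * _)%E.
by apply: eq_bigr => i _; rewrite inord_val.
Qed.

Let empirical_setT : empirical setT = 1%E.
Proof.
rewrite empiricalE; under eq_bigr do rewrite diracT.
by rewrite sumEFin sumr_const card_ord -EFinM mulVf.
Qed.

HB.instance Definition _ :=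
  Measure_isProbability.Build _ _ _ empirical empirical_setT.

End measure.

Lemma sum_dirac (n : nat) (w : 'I_n -> T) (A : set T) :
  (\sum_(i < n) \d_(w i) A = (\sum_(i < n) \1_A (w i) : R)%:E)%E.
Proof. by rewrite sumEFin. Qed.

Lemma empirical_measuresP (Omega : set T) (n : nat) (mu : probability T R) :
  empirical_measures Omega n.+1 mu ->
  exists2 w : 'I_n.+1 -> T, (forall i, Omega (w i)) &
    forall A, measurable A -> mu A = empirical w A.
Proof.
by move=> [w [Ow muE]]; exists w => // A /muE ->; rewrite empiricalE.
Qed.

Lemma empirical_empirical_measures (Omega : set T) (n : nat)
    (w : 'I_n.+1 -> T) : (forall i, Omega (w i)) ->
  empirical_measures Omega n.+1 (empirical w : probability T R).
Proof. by move=> Ow; exists w; split => // A _; exact: empiricalE. Qed.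

Lemma empirical_measures_prob_on (Omega : set T) (n : nat) :
  measurable Omega ->
  empirical_measures Omega n.+1 `<=` (prob_on Omega : set (probability T R)).
Proof.
move=> mO mu [w [Ow muE]]; rewrite /prob_on/= muE//.
under eq_bigr do rewrite diracE mem_set//.
by rewrite sumEFin sumr_const card_ord -EFinM mulVf.
Qed.

(** The integral is additive in the measure for nonnegative integrands; the positive and negative
    parts of [f] then recombine at each atom. *)
Lemma Rintegral_empirical (D : set T) (n : nat) (w : 'I_n.+1 -> T) (f : T -> R) :
  measurable D -> (forall i, D (w i)) -> measurable_fun D f ->
  \int[empirical w]_(x in D) f x = n.+1%:R^-1 * \sum_(i < n.+1) f (w i).
Proof.
move=> mD Dw mf.
have H (g : T -> R) : (forall x, 0 <= g x) -> measurable_fun D g ->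
    (\int[empirical w]_(x in D) (g x)%:E =
      (n.+1%:R^-1 * \sum_(i < n.+1) g (w i))%:E)%E.
  move=> g0 /measurable_EFinP mg; rewrite ge0_integral_mscale//; last first.
    by move=> x _; rewrite lee_fin.
  rewrite ge0_integral_measure_sum//; last by move=> x _; rewrite lee_fin.
  rewrite EFinM -sumEFin; congr (_ * _)%E.
  apply: eq_bigr => i _.
  by rewrite integral_dirac// inord_val diracE mem_set// mul1e.
rewrite /Rintegral integralE.
have -> : (EFin \o f)^\+%E = (EFin \o (fun x => Num.max (f x) 0)).
  by apply/funext => x /=; rewrite funeposE EFin_max.
have -> : (EFin \o f)^\-%E = (EFin \o (fun x => Num.max (- f x) 0)).
  by apply/funext => x /=; rewrite funenegE EFin_max.
rewrite !H; first last.
- exact: measurable_maxr.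
- by move=> x; rewrite le_max lexx orbT.
- by apply: measurable_maxr => //; exact/measurableT_comp.
- by move=> x; rewrite le_max lexx orbT.
rewrite -EFinB/= -mulrBr -sumrB; congr (_ * _); apply: eq_bigr => i _.
by rewrite !maxEle; case: ifPn => ?; case: ifPn => ?; lra.
Qed.

End empirical.

(** * Total variation of a difference of probability measures *)

Section total_variation.
Context {d : measure_display} {T : measurableType d} {R : realType}.

Lemma tv_norm_ge0 (sigma : {charge set T -> \bar R}) : 0 <= tv_norm sigma.
Proof.
rewrite /tv_norm; case: cid => P [N sPN]; case: cid => {}N {}sPN.
exact/fine_ge0/adde_ge0.
Qed.

(** On a Hahn decomposition the norm is the value of [nu - mu] at [P] minus its value at [N]. Each
    of the two contributes at most [e], whence the factor 2. *)
Lemma tv_norm_charge_diff_le (nu mu : probability T R) (e : R) :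
  (forall A, measurable A -> `|nu A - mu A| <= e%:E)%E ->
  tv_norm (charge_diff nu mu) <= 2 * e.
Proof.
move=> numu; rewrite /tv_norm; case: cid => P exN; case: cid => N sPN.
have [[mP _] [mN _] _ _] := sPN.
rewrite -lee_fin fineK; last first.
  by rewrite fin_numD !fin_num_measure.
rewrite /charge_variation/= jordan_posE jordan_negE cjordan_posE cjordan_negE.
rewrite /crestr0 mem_set// /crestr !setTI mulr_natl mulr2n EFinD.
apply: leeD.
  by apply: le_trans (numu _ mP); exact: lee_abs.
by apply: le_trans (numu _ mN); rewrite -abseN; exact: lee_abs.
Qed.

End total_variation.

(** * Convexity, smoothness and the replacement of one atom *)

Section smooth_convex.
Context {d : measure_display} {T : measurableType d} {R : realType}.
Variables (Omega : set T) (F : probability T R -> R).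
Hypothesis mOmega : measurable Omega.

(** Convexity bounds each difference quotient with [0 < t <= 1] by [F nu - F mu], and the bound
    survives the limit. *)
Lemma int_diff_le (mu nu : probability T R) (f : T -> R) :
  convex_on_prob Omega F -> first_variation Omega F mu f ->
  prob_on Omega mu -> prob_on Omega nu ->
  int_diff Omega nu mu f <= F nu - F mu.
Proof.
move=> cF dF Omu Onu; apply: (cvgr_to_le (dF nu Onu)).
near=> t.
have t0 : 0 < t by [].
have t1 : t <= 1 by near: t; exact: nbhs_right_le.
have tE : (clamp01 t)%:num = t.
  by rewrite /= (min_idPl t1) (max_idPr (ltW t0)).
rewrite ler_pdivrMr//.
by have := cF mu nu Omu Onu (clamp01 t); rewrite tE; lra.
Unshelve. all: by end_near. Qed.

Lemma Rintegral_cst_prob_on (nu : probability T R) (c : R) :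
  prob_on Omega nu -> \int[nu]_(_ in Omega) c = c.
Proof.
move=> Onu; rewrite Rintegral_cst// -[RHS]mulr1; congr (_ * _).
exact: (congr1 fine Onu).
Qed.

(** Otherwise [f] exceeds its integral plus [e] on all of [Omega]; integrating against [nu] is
    contradictory. The slack [e] makes weak monotonicity of the integral sufficient. *)
Lemma exists_le_Rintegral (nu : probability T R) (f : T -> R) (e : R) :
  prob_on Omega nu -> measurable_fun Omega f -> [bounded f x | x in Omega] ->
  0 < e -> exists2 y, Omega y & f y <= \int[nu]_(x in Omega) f x + e.
Proof.
move=> Onu mf bf e0; apply: contrapT => /forall2NP H.
set I := \int[nu]_(x in Omega) f x.
have Ofin : (nu Omega < +oo)%E by rewrite Onu ltry.
have : \int[nu]_(x in Omega) (I + e) <= I.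
  apply: le_Rintegral => //.
  - exact: finite_measure_integrable_cst.
  - exact: measurable_bounded_integrable.
  - by move=> x Ox; have [//|/negP] := H x; rewrite -ltNge => /ltW.
rewrite Rintegral_cst_prob_on//; lra.
Qed.

Lemma exists_ge_mean (n : nat) (a : 'I_n.+1 -> R) :
  exists i, n.+1%:R^-1 * \sum_(j < n.+1) a j <= a i.
Proof.
exists [arg max_(i > ord0) a i]%O.
case: arg_maxP => // i _ ai.
rewrite ler_pdivrMl// mulr_natl -[n.+1 in leRHS]card_ord -sumr_const.
by apply: ler_sum => j _; exact: ai.
Qed.

(** On any measurable set only the [i]-th Dirac term changes, and by at most 1 before
    normalization. *)
Lemma tv_norm_swap_atom (n : nat) (w : 'I_n.+1 -> T) (i : 'I_n.+1) (y : T)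
    (mu : probability T R) :
  (forall A, measurable A -> mu A = empirical w A) ->
  tv_norm (charge_diff (empirical (fun j => if j == i then y else w j)) mu)
    <= 2 * n.+1%:R^-1.
Proof.
move=> muE; apply: tv_norm_charge_diff_le => A mA.
rewrite muE// empiricalE [X in (X - _)%E]empiricalE !sum_dirac -!EFinM.
rewrite -EFinB lee_fin -mulrBr -sumrB.
rewrite (bigD1 i)//= eqxx big1 ?addr0; last first.
  by move=> j /negPf ->; rewrite subrr.
rewrite normrM ger0_norm// ler_piMr//.
by rewrite !indicE; case: (_ \in _); case: (_ \in _);
  rewrite ?subrr ?subr0 ?sub0r ?normrN ?normr1 ?normr0.
Qed.

Lemma int_diff_swap_atom (n : nat) (w : 'I_n.+1 -> T) (i : 'I_n.+1) (y : T)
    (mu : probability T R) (f : T -> R) :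
  (forall A, measurable A -> mu A = empirical w A) ->
  (forall j, Omega (w j)) -> Omega y -> measurable_fun Omega f ->
  int_diff Omega (empirical (fun j => if j == i then y else w j)) mu f
    = n.+1%:R^-1 * (f y - f (w i)).
Proof.
move=> muE Ow Oy mf; rewrite /int_diff.
have -> : \int[mu]_(x in Omega) f x = \int[empirical w]_(x in Omega) f x.
  by congr fine; apply: eq_measure_integral => A mA _; exact: muE.
rewrite !Rintegral_empirical//; last by move=> j; case: ifP.
rewrite -mulrBr -sumrB (bigD1 i)//= eqxx big1 ?addr0//.
by move=> j /negPf ->; rewrite subrr.
Qed.

Lemma swap_atom_descent (l : R) (n : nat) (mu nu : probability T R)
    (f : T -> R) (e : R) :
  convex_on_prob Omega F -> 0 <= l -> 0 < e ->
  empirical_measures Omega n.+1 mu -> prob_on Omega nu ->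
  measurable_fun Omega f -> [bounded f x | x in Omega] ->
  first_variation Omega F mu f ->
  (forall nu', prob_on Omega nu' ->
    F nu' <= F mu + int_diff Omega nu' mu f
             + l / 2 * tv_norm (charge_diff nu' mu) ^+ 2) ->
  exists2 mu' : probability T R, empirical_measures Omega n.+1 mu' &
    F mu' <= F mu + n.+1%:R^-1 * (F nu - F mu + e) + 2 * l * n.+1%:R^-1 ^+ 2.
Proof.
move=> cF l0 e0 Emu Onu mf bf dF sF.
have Omu := empirical_measures_prob_on mOmega Emu.
have [w Ow muE] := empirical_measuresP Emu.
have [y Oy fy] := exists_le_Rintegral Onu mf bf e0.
have [i fi] := exists_ge_mean (fun j => f (w j)).
pose mu' : probability T R := empirical (fun j => if j == i then y else w j).
have Emu' : empirical_measures Omega n.+1 mu'.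
  by apply: empirical_empirical_measures => j; case: ifP.
exists mu' => //.
have dF_le : int_diff Omega mu' mu f <= n.+1%:R^-1 * (F nu - F mu + e).
  rewrite [leLHS](int_diff_swap_atom i muE Ow Oy mf) ler_pM2l ?invr_gt0//.
  have muf : \int[mu]_(x in Omega) f x = n.+1%:R^-1 * \sum_(j < n.+1) f (w j).
    rewrite -(Rintegral_empirical mOmega Ow mf).
    by congr fine; apply: eq_measure_integral => A mA _; exact: muE.
  (* With [m] the mean of [f] over the atoms, [f y - f (w i)] is at most the [nu]-integral of [f]
     plus [e - m], which convexity bounds by [F nu - F mu + e]. *)
  have := int_diff_le cF dF Omu Onu.
  rewrite /int_diff muf; move: fi fy => /=; set m := _ * _; lra.
have tv_le : l / 2 * tv_norm (charge_diff mu' mu) ^+ 2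
    <= 2 * l * n.+1%:R^-1 ^+ 2.
  have -> : 2 * l * n.+1%:R^-1 ^+ 2 = l / 2 * (2 * n.+1%:R^-1) ^+ 2 :> R.
    by field.
  rewrite ler_wpM2l ?divr_ge0// lerXn2r ?nnegrE ?mulr_ge0// ?tv_norm_ge0//.
  exact: tv_norm_swap_atom.
apply: le_trans (sF _ (empirical_measures_prob_on mOmega Emu')) _.
by apply: lerD tv_le; rewrite lerD2l.
Qed.

(** The tangent inequality at a single [mu], whose first variation is bounded, bounds [F] below;
    this makes the infima finite. *)
Lemma convex_smooth_lower_bound (mu : probability T R) :
  convex_on_prob Omega F -> smooth_on_prob Omega F -> prob_on Omega mu ->
  exists M : R, forall nu, prob_on Omega nu -> M <= F nu.
Proof.
move=> cF [l [_ [F' sF]]] Omu; have [mf bf dF _] := sF _ Omu.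
have [M [_ bM]] := bf.
have {}bM x : Omega x -> - (`|M| + 1) <= F' mu x.
  (* Boundedness gives the estimate for every constant strictly above [M], and this is one. *)
  move=> Ox; have : `|F' mu x| <= `|M| + 1.
    by apply: bM => //; rewrite (le_lt_trans (ler_norm M))// ltrDl.
  by rewrite ler_norml => /andP[].
exists (F mu - \int[mu]_(x in Omega) F' mu x - (`|M| + 1)) => nu Onu.
have := int_diff_le cF dF Omu Onu; rewrite /int_diff.
have Ofin : (nu Omega < +oo)%E by rewrite (Onu : nu Omega = 1%E) ltry.
have : \int[nu]_(x in Omega) (- (`|M| + 1)) <= \int[nu]_(x in Omega) F' mu x.
  apply: le_Rintegral => //.
  - exact: finite_measure_integrable_cst.
  - exact: measurable_bounded_integrable.
rewrite Rintegral_cst_prob_on//; lra.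
Qed.

End smooth_convex.

(** * Measurability of compact sets, and passage to the infima *)

Lemma compact_measurable_borel_rV (R : realType) (d : nat)
    (K : set (borel_rV R d)) :
  compact (K : set 'rV[R]_d) -> measurable K.
Proof.
move=> cK; rewrite -(setCK K); apply: measurableC.
apply: sub_sigma_algebra; rewrite openC.
exact: compact_closed.
Qed.

Theorem lemma6p2 (R : realType) (d : nat) (Omega : set (borel_rV R d))
    (F : probability (borel_rV R d) R -> R) :
  compact (Omega : set 'rV[R]_d) ->
  convex_on_prob Omega F ->
  smooth_on_prob Omega F ->
  exists C : R, forall n : nat, (0 < n)%N ->
    (ereal_inf [set (F mu)%:E | mu in empirical_measures Omega n]
       - ereal_inf [set (F mu)%:E | mu in prob_on Omega]
     <= (C / n%:R)%:E)%E.
Proof.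
move=> /compact_measurable_borel_rV mO cF sF.
have [l [l0 [F' sF']]] := sF.
exists (2 * l) => -[//|n] _.
set A := [set _ | _ in empirical_measures _ _].
set B := [set _ | _ in prob_on _].
(* If there is no probability measure on [Omega], the subtracted infimum is [+oo], and adding [-oo]
   to anything yields [-oo]. *)
have [B0|/set0P[_ [nu0 Onu0 _]]] := eqVneq B set0.
  by rewrite B0 ereal_inf0 /= addeNy leNye.
have [w0 Ow0] : exists w0, Omega w0.
  apply/set0P/eqP => O0.
  move: Onu0; rewrite /prob_on/= O0 measure0 => /eqP.
  by rewrite eq_sym onee_eq0.
have Emu0 := empirical_empirical_measures (R := R) (fun _ : 'I_n.+1 => Ow0).
have Omu0 := empirical_measures_prob_on mO Emu0.
have [M FM] := convex_smooth_lower_bound mO cF sF Omu0.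
have Afin : ereal_inf A \is a fin_num.
  apply/fin_numPlt/andP; split.
    apply: (@lt_le_trans _ _ M%:E); first exact: ltNyr.
    apply: le_ereal_inf_tmp => _ [mu /(empirical_measures_prob_on mO) Omu <-].
    by rewrite lee_fin FM.
  apply: (@le_lt_trans _ _ (F (empirical (fun _ : 'I_n.+1 => w0)))%:E).
    by apply: ereal_inf_lbound; exists (empirical (fun _ : 'I_n.+1 => w0)).
  exact: ltry.
have Bfin : ereal_inf B \is a fin_num.
  apply/fin_numPlt/andP; split.
    apply: (@lt_le_trans _ _ M%:E); first exact: ltNyr.
    by apply: le_ereal_inf_tmp => _ [mu Omu <-]; rewrite lee_fin FM.
  apply: (@le_lt_trans _ _ (F nu0)%:E); last exact: ltry.
  by apply: ereal_inf_lbound; exists nu0.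
apply/lee_addgt0Pr => e e0.
(* With [N] atoms and slack [e'], the errors after multiplying by [N] are [(N - 1) * e'] from [mu],
   [e'] from [nu] and [e'] from the descent step: in total [(N + 1) * e'], at most
   [2 * N * e' = e]. *)
have e'0 : 0 < e / (2 * n.+1%:R) by rewrite divr_gt0// mulr_gt0.
have [_ [mu Emu <-]] := lb_ereal_inf_adherent e'0 Afin.
have [_ [nu Onu <-]] := lb_ereal_inf_adherent e'0 Bfin.
rewrite -(fineK Afin) -(fineK Bfin) -EFinB -!EFinD !lte_fin lee_fin.
have [mf bf dF sFmu] := sF' _ (empirical_measures_prob_on mO Emu).
have [mu' Emu' Fmu'] := swap_atom_descent mO cF l0 e'0 Emu Onu mf bf dF sFmu.
have : fine (ereal_inf A) <= F mu'.
  by rewrite -lee_fin fineK//; apply: ereal_inf_lbound; exists mu'.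
set a := fine (ereal_inf A); set b := fine (ereal_inf B) => aF Fnu Fmu.
have N1 : 1 <= n.+1%:R :> R by rewrite ler1n.
move: N1 e'0 Fnu Fmu Fmu'; set N : R := n.+1%:R; set e' := e / _ => N1 e'0 Fnu Fmu Fmu'.
have N0 : 0 < N by apply: lt_le_trans N1.
have eE : e = 2 * N * e' by rewrite /e'; field; rewrite gt_eqF.
have H : N * a <= (N - 1) * F mu + F nu + e' + 2 * l / N.
  have -> : (N - 1) * F mu + F nu + e' + 2 * l / N =
      N * (F mu + N^-1 * (F nu - F mu + e') + 2 * l * N^-1 ^+ 2).
    by field; rewrite gt_eqF.
  by rewrite ler_pM2l// (le_trans aF).
(* Since [N - 1] is nonnegative, [F mu] may be replaced by its upper bound; subtracting
   [(N - 1) * a] from [N * a] leaves a single [a] to compare with [b]. *)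
have : (N - 1) * F mu <= (N - 1) * (a + e').
  by rewrite ler_wpM2l ?subr_ge0// ltW.
have : e' <= N * e' by rewrite ler_peMl// ltW.
clearbody N e' a b.
rewrite eE; lra.
Qed.
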